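(* Let $x_1,\ldots,x_7$ be an enumeration of the nodes (points) and $\ell_1,\ldots,\ell_7$ an enumeration of the lines of the Fano plane on the node set $\{1,\ldots,7\}$, such that $x_r\in\ell_r$ for $r=1,\ldots,7$. For each $r$, let $T_r$ be the knockout tournament on the $8$ players $0,1,\ldots,7$ that arises from the node-line pair $(x_r,\ell_r)$. Then the Serial Knockout Competition $\mathcal{T}:=\{T_1,\ldots,T_7\}$ is stable.
   Context: Knockout tournaments. A (balanced) knockout tournament $T$ on $n=2^k$ players is given by a seeding, i.e. an ordering $s=s_0s_1\cdots s_{n-1}$ of the players assigned from left to right to the leaves of a complete binary tree of depth $k$. In round $1$ the players in positions $2j$ and $2j+1$ meet; in each later round, the winners of the two subtrees below a node meet. For distinct players $x,x'$ we write $v_T(x,x')=i$ if $x,x'$ can meet in round $i$ of $T$ (assuming both win all earlier matches); equivalently, if $x,x'$ are in positions $p,p'$, then $i\in\{1,\ldots,k\}$ is the smallest integer with $\lfloor p/2^i\rfloor=\lfloor p'/2^i\rfloor$. Stability. A set $\mathcal{T}$ of knockout tournaments on the same $n=2^k$ players is stable in round $i$ if there is a number $c_i$ such that $\#\{T\in\mathcal{T}: v_T(x,x')=i\}=c_i$ for all pairs of distinct players $x,x'$. The set $\mathcal{T}$ is stable if it is stable in all rounds $i=1,\ldots,k$. A Serial Knockout Competition (SKC) for $n=2^k$ players is a competition consisting of $n-1$ knockout tournaments on these players. Fano plane. The nodes are $1,\ldots,7$ and the lines are $\{3,5,6\},\{2,4,6\},\{1,2,3\},\{1,6,7\},\{3,4,7\},\{1,4,5\},\{2,5,7\}$.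 Tournament arising from a node-line pair. Let $x$ be a node and $\ell$ a line with $x\in\ell$. Write $\ell=\{x,a,b\}$ and let $\{x,c,d\}$ and $\{x,e,f\}$ be the other two lines through $x$. The knockout tournament arising from $(x,\ell)$ has players $0,1,\ldots,7$ and seeding $0\,x\,a\,b\,c\,d\,e\,f$. (So $0$ and $x$ meet in round $1$, as do $a,b$, and $c,d$, and $e,f$; the winners of $\{0,x\}$ and $\{a,b\}$ meet in round $2$, as do the winners of $\{c,d\}$ and $\{e,f\}$. The choices in naming $a,b$, in naming $c,d$, in naming $e,f$, and in ordering the two remaining lines do not affect $v_T$.) *)

(* Defs.v *)
From mathcomp Require Import all_boot all_fingroup.

Set Implicit Arguments.
Unset Strict Implicit.
Unset Printing Implicit Defensive.

(* A tournament on the players 'I_(2^k) is its seeding: [T p] is the player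
   at position p (leaves counted from left to right, starting from 0). *)
Definition tournament (k : nat) := 'S_(2 ^ k).

Definition seeding k (T : tournament k) : seq 'I_(2 ^ k) :=
  [seq T p | p <- enum 'I_(2 ^ k)].

Definition position k (T : tournament k) (x : 'I_(2 ^ k)) : 'I_(2 ^ k) :=
  (T^-1)%g x.

(* The smallest i in {1, .., k} such that the positions of x and y have the
   same quotient by 2 ^ i; this is only meaningful for x != y. *)
Definition meeting_round k (T : tournament k) (x y : 'I_(2 ^ k)) : nat :=
  head 0 [seq i <- iota 1 k |
            position T x %/ 2 ^ i == position T y %/ 2 ^ i].

Definition stable_in_round k (TT : {set tournament k}) (i : nat) : Prop :=
  exists c : nat, forall x y : 'I_(2 ^ k), x != y ->
    #|[set T in TT | meeting_round T x y == i]| = c.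

Definition stable k (TT : {set tournament k}) : Prop :=
  forall i : nat, 1 <= i <= k -> stable_in_round TT i.

Definition serial_knockout_competition k (TT : {set tournament k}) : Prop :=
  #|TT| = 2 ^ k - 1.

Definition enumeration (T : finType) (A : {set T}) n (f : 'I_n -> T) : Prop :=
  injective f /\ [set f r | r : 'I_n] = A.

(* The nodes 1, .., 7 of the Fano plane are taken inside the type 'I_8 of the
   players 0, .., 7, so that a node is directly a player. *)
Definition fano_nodes : {set 'I_8} := [set x : 'I_8 | 0 < x].

Definition triple (a b c : nat) : {set 'I_8} :=
  [set inord a; inord b; inord c].

Definition fano_lines : {set {set 'I_8}} :=
  [set:: [:: triple 3 5 6; triple 2 4 6; triple 1 2 3; triple 1 6 7;
             triple 3 4 7; triple 1 4 5; triple 2 5 7]].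

(* T arises from (x, l) for some choice of the names a, b, c, d, e, f and of
   the order of the other two lines through x. *)
Definition arises_from (x : 'I_8) (l : {set 'I_8}) (T : tournament 3) : Prop :=
  exists a b c d e f : 'I_8,
    [/\ l = [set x; a; b],
        [set x; c; d] \in fano_lines /\ [set x; e; f] \in fano_lines,
        [/\ [set x; c; d] != l, [set x; e; f] != l
          & [set x; c; d] != [set x; e; f]]
      & seeding T = [:: ord0; x; a; b; c; d; e; f]].

(* Main.v *)
Require Import Defs.
From mathcomp Require Import all_boot all_fingroup.

(* Identify the players 0, .., 7 with the vectors of F_2^3 through binary
   expansions. The Fano lines are then exactly the triples of distinct nonzero
   vectors with sum 0, so a flag (x, l) gives a chain of subgroups
   {0, x} < {0} :|: l < F_2^3, and the first 2^i positions of the seeding (and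
   all later blocks of this size) are cosets of the i-th one. Hence y and z
   meet in round 1 iff y + z = x, in round 2 iff y + z is another point of l,
   and in round 3 otherwise. As y + z is a nonzero vector w, which is x_r for
   one r and lies on l_r for three r, the pair meets 1, 2 and 4 times in these
   rounds. *)

(** Points are plain numbers and [l] is a predicate, so that the same formula serves a computable
    list in the finite check and a set of players, through [inord], afterwards. *)
Definition flag_round (x : nat) (l : pred nat) (w : nat) : nat :=
  if w == x then 1 else if l w then 2 else 3.

Definition xor_flag_seeding (x a c e : nat) : seq nat :=
  [:: 0; x; a; Nat.lxor x a; c; Nat.lxor x c; e; Nat.lxor x e].

(** A finite check by evaluation over all 8^4 choices of [x], [a], [c], [e]; the guard [uniq s]
    keeps the choices that seed all eight players. *)
Lemma flag_round_xor_seeding :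
  all (fun x => all (fun a => all (fun c => all (fun e =>
    let s := xor_flag_seeding x a c e in
    uniq s ==> all (fun p => all (fun q => (p != q) ==>
      (head 0 [seq i <- iota 1 3 | p %/ 2 ^ i == q %/ 2 ^ i] ==
       flag_round x (mem [:: x; a; Nat.lxor x a])
         (Nat.lxor (nth 0 s p) (nth 0 s q))))
    (iota 0 8)) (iota 0 8))
  (iota 0 8)) (iota 0 8)) (iota 0 8)) (iota 0 8).
Proof. by vm_compute. Qed.

Lemma lxor_neq_bounds :
  all (fun y => all (fun z => (y != z) ==> (0 < Nat.lxor y z < 8))
    (iota 0 8)) (iota 0 8).
Proof. by vm_compute. Qed.

Lemma mem_triple (a b c : nat) (y : 'I_8) : a < 8 -> b < 8 -> c < 8 ->
  (y \in triple a b c) = [|| y == a :> nat, y == b :> nat | y == c :> nat].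
Proof. by move=> ? ? ?; rewrite !inE -!val_eqE /= !inordK // -orbA. Qed.

Lemma fano_line_xor (a b c : 'I_8) :
  [set a; b; c] \in fano_lines -> uniq [:: a; b; c] -> c = Nat.lxor a b :> nat.
Proof.
(* The six equations match the six orders in which [a], [b], [c] can run through a line; the
   non-injective assignments contradict [uniq]. *)
have xor_triple (i j k : nat) :
    [&& i < 8, j < 8, k < 8, Nat.lxor i j == k, Nat.lxor j i == k,
        Nat.lxor i k == j, Nat.lxor k i == j, Nat.lxor j k == i
      & Nat.lxor k j == i] ->
    [set a; b; c] = triple i j k -> uniq [:: a; b; c] ->
    c = Nat.lxor a b :> nat.
  case/and5P=> i8 j8 k8 /eqP ij /and5P[/eqP ji /eqP ik /eqP ki /eqP jk /eqP kj].
  move=> E; rewrite /= !inE negb_or -!val_eqE /= andbT => /andP[/andP[ab ac] bc].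
  have := mem_triple i j k a i8 j8 k8; have := mem_triple i j k b i8 j8 k8.
  have := mem_triple i j k c i8 j8 k8; rewrite -E !inE !eqxx !orbT /=.
  move=> /esym/or3P[]/eqP Ec /esym/or3P[]/eqP Eb /esym/or3P[]/eqP Ea;
    by move: ab ac bc; rewrite Ea Eb Ec ?eqxx.
rewrite inE !in_cons in_nil orbF.
by do 6?[case/orP]; move/eqP; apply: xor_triple.
Qed.

Lemma meeting_round_arises_from (x : 'I_8) (l : {set 'I_8}) (T : tournament 3)
    (y z w : 'I_8) :
  l \in fano_lines -> arises_from x l T -> y != z ->
  w = Nat.lxor y z :> nat ->
  meeting_round T y z = flag_round x (fun n => inord n \in l) w.
Proof.
move=> lF [a [b [c [d [e [f [El [cdF efF] _ sT]]]]]]] yz Ew.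
have uT : uniq (seeding T).
  by rewrite map_inj_uniq ?enum_uniq //; apply: perm_inj.
have nthT (p : 'I_(2 ^ 3)) : nth 0 (map val (seeding T)) p = T p.
  by rewrite -map_comp (nth_map p) ?size_enum_ord // nth_ord_enum.
have uniq_sub m : uniq (mask m [:: ord0; x; a; b; c; d; e; f]).
  by rewrite -sT mask_uniq.
(* Each of [b], [d], [f] completes a line through [x], so the seeding is determined by [x], [a],
   [c], [e] and falls under the finite check. *)
have Eb : b = Nat.lxor x a :> nat.
  apply: fano_line_xor; first by rewrite -El.
  exact: (uniq_sub [:: false; true; true; true]).
have Ed : d = Nat.lxor x c :> nat.
  apply: fano_line_xor => //.
  exact: (uniq_sub [:: false; true; false; false; true; true]).
have Ef : f = Nat.lxor x e :> nat.
  apply: fano_line_xor => //.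
  exact: (uniq_sub [:: false; true; false; false; false; false; true; true]).
have sE : map val (seeding T) = xor_flag_seeding x a c e.
  by rewrite sT /= /xor_flag_seeding Eb Ed Ef.
have in8 (i : 'I_8) : (i : nat) \in iota 0 8 by rewrite mem_iota /=.
have := flag_round_xor_seeding.
move=> /allP/(_ _ (in8 x))/allP/(_ _ (in8 a))/allP/(_ _ (in8 c)).
move=> /allP/(_ _ (in8 e)); lazy beta zeta.
rewrite -sE map_inj_uniq; last exact: val_inj.
rewrite uT => /allP/(_ _ (in8 (position T y))).
move=> /allP/(_ _ (in8 (position T z))) /implyP.
have neq : position T y != position T z :> nat.
  by rewrite val_eqE (inj_eq perm_inj).
move=> /(_ neq)/eqP; rewrite -/(meeting_round T y z) => ->.
rewrite !nthT !permKV -Ew /flag_round.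
by rewrite El inord_val !inE -!val_eqE /= -Eb -orbA.
Qed.

Lemma count_fano_lines_through (l : 'I_7 -> {set 'I_8}) (w : 'I_8) :
  enumeration fano_lines l -> 0 < w -> #|[set r | w \in l r]| = 3.
Proof.
move=> [l_inj l_im] w0.
pose L := [:: triple 3 5 6; triple 2 4 6; triple 1 2 3; triple 1 6 7;
              triple 3 4 7; triple 1 4 5; triple 2 5 7].
have lL : {subset codom l <= L}.
  move=> _ /codomP[r ->].
  have : l r \in fano_lines by rewrite -l_im imset_f.
  by rewrite inE.
have ul : uniq (codom l) by apply/injectiveP.
have szL : size L <= size (codom l) by rewrite size_codom card_ord.
(* Seven distinct lines inside a list of length seven exhaust it, which also shows that the triples
   in [L] are distinct without comparing them. *)
have [_ Ll] := uniq_min_size ul lL szL.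
have uL : uniq L by rewrite (uniq_size_uniq ul Ll) size_codom card_ord.
have -> : #|[set r | w \in l r]| =
    count (fun m : {set 'I_8} => w \in m) (codom l).
  rewrite cardsE cardE size_filter -enumT [in RHS]count_map.
  exact: eq_count.
have /seq.permP -> : perm_eq (codom l) L by apply: uniq_perm.
rewrite /= !mem_triple //.
by case: w w0 => [[|[|[|[|[|[|[|[|n]]]]]]]] w8].
Qed.

Theorem theorem2p1 (x : 'I_7 -> 'I_8) (l : 'I_7 -> {set 'I_8})
    (T : 'I_7 -> tournament 3) :
  enumeration fano_nodes x ->
  enumeration fano_lines l ->
  (forall r : 'I_7, x r \in l r) ->
  (forall r : 'I_7, arises_from (x r) (l r) (T r)) ->
  serial_knockout_competition [set T r | r : 'I_7] /\
  stable [set T r | r : 'I_7].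
Proof.
move=> [x_inj x_im] l_enum xl arT.
(* The player at position 1 of [T r] is [x r], and [x] is injective. *)
have T_inj : injective T.
  move=> r r' E; apply: x_inj.
  have [? [? [? [? [? [? [_ _ _ sr]]]]]]] := arT r.
  have [? [? [? [? [? [? [_ _ _ sr']]]]]]] := arT r'.
  by move: sr'; rewrite -E sr => -[].
split; first by rewrite /serial_knockout_competition card_imset ?card_ord.
(* The entry at index 0 is padding, since rounds start at 1. *)
move=> i i13; exists (nth 0 [:: 0; 1; 2; 4] i) => y z yz.
have /andP[w0 w8] : 0 < Nat.lxor y z < 8.
  have in8 (j : 'I_8) : (j : nat) \in iota 0 8 by rewrite mem_iota /=.
  have := allP (allP lxor_neq_bounds _ (in8 y)) _ (in8 z).
  by rewrite val_eqE yz.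
pose w := Ordinal w8.
have -> : [set U in [set T r | r : 'I_7] | meeting_round U y z == i] =
    T @: [set r | flag_round (x r) (fun n => inord n \in l r) w == i].
  have lF r : l r \in fano_lines by rewrite -l_enum.2 imset_f.
  have roundE r :=
    meeting_round_arises_from _ _ _ _ _ w (lF r) (arT r) yz erefl.
  apply/setP=> U; rewrite inE; apply/andP/imsetP.
    move=> [/imsetP[r _ ->]].
    by rewrite roundE => rd; exists r; rewrite ?inE.
  by move=> [r rd ->]; rewrite roundE imset_f //; move: rd; rewrite inE.
rewrite card_imset //.
have card_x : #|[set r | w == x r]| = 1.
  have /imsetP[r _ ->] : w \in [set x r | r : 'I_7] by rewrite x_im inE.
  by apply/eqP/cards1P; exists r; apply/setP => r';
    rewrite !inE (inj_eq x_inj) eq_sym.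
have card_l := count_fano_lines_through l w l_enum w0.
rewrite /flag_round inord_val.
case: i i13 => [|[|[|[|i]]]] //= _.
- rewrite -[RHS]card_x; apply: eq_card => r; rewrite !inE -val_eqE /=.
  by do 2?case: ifP.
(* Round 2: since [x r] lies on [l r], the one index with [x r = w] is among the three with [w] on
   [l r], which leaves 3 - 1 = 2. *)
- transitivity #|[set r | w \in l r] :\: [set r | w == x r]|.
    by apply: eq_card => r; rewrite !inE -val_eqE /=; do 2?case: ifP.
  rewrite cardsD card_l (_ : _ :&: _ = [set r | w == x r]) ?card_x //.
  by apply/setIidPr/subsetP => r; rewrite !inE => /eqP ->.
(* Round 3: [w] off [l r] already excludes [w = x r], so the count is 7 - 3 = 4. *)
- transitivity #|~: [set r | w \in l r]|; last first.
    by rewrite cardsCs setCK card_l card_ord.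
  apply: eq_card => r; rewrite !inE.
  rewrite -[_ == nat_of_ord _]/(w == x r).
  by case: (w =P x r) => [->|_]; rewrite ?xl //; case: ifP.
Qed.
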